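(* Consider the control-affine system $\dot{\boldsymbol{x}}=f(\boldsymbol{x})+g(\boldsymbol{x})\boldsymbol{u}$ with $\boldsymbol{x}\in\mathbb{R}^n$, $\boldsymbol{u}\in\mathbb{R}^q$, $f,g$ locally Lipschitz, control bounds $\boldsymbol{u}_{min}\le\boldsymbol{u}\le\boldsymbol{u}_{max}$ (componentwise), and let $b:\mathbb{R}^n\to\mathbb{R}$ be an AVCBF with corresponding $\mathcal{A}_i$, $\boldsymbol{Z}$, $\boldsymbol{V}$, $\psi_i$, $\mathcal{C}_0,\dots,\mathcal{C}_{m_a-1}$ as in the context. For $j\in\{1,\dots,m_a\}$ write $L_{\mathcal{F}_j}^{m_a+1-j}\mathcal{A}_j+L_{\mathcal{G}_j}L_{\mathcal{F}_j}^{m_a-j}\mathcal{A}_j\boldsymbol{v}_j = L_{\mathcal{F}_j}^{m_a+1-j}\mathcal{A}_j+B_j\boldsymbol{u}+B_j^\nu\nu_j$, where $B_j^\nu$ is the coefficient of $\nu_j$. Suppose $\boldsymbol{Z}(0)\in\mathcal{C}_0\cap\dots\cap\mathcal{C}_{m_a-1}$ and each $B_j^\nu$, $j\in\{1,\dots,m_a\}$, is always positive. Then the quadratic program $$\min_{\boldsymbol{u},\nu_1,\dots,\nu_{m_a},\delta}\ \|\boldsymbol{u}\|^2+\sum_{i=1}^{m_a}W_i(\nu_i-a_{i,w})^2+Q\delta^2$$ subject to (i) the relaxed CLF constraint $L_fV(\boldsymbol{x})+L_gV(\boldsymbol{x})\boldsymbol{u}+c_3V(\boldsymbol{x})\le\delta$,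 (ii) $\boldsymbol{u}_{min}\le\boldsymbol{u}\le\boldsymbol{u}_{max}$, (iii) $\boldsymbol{V}\in\mathcal{U}_{\boldsymbol{V}}(\boldsymbol{Z})$, and (iv) the AVCBF constraint $\psi_{m_a}(\boldsymbol{Z},\boldsymbol{V})\ge0$, is point-wise feasible for any $\boldsymbol{Z}$ lying inside $\mathcal{C}_{m_a-1}$; i.e., the problem is solvable with a unique solution $\boldsymbol{V}^*$ for any $\boldsymbol{Z}$ with $\psi_{m_a-1}(\boldsymbol{Z})>0$.
   Context: A class $\kappa$ function is a continuous, strictly increasing $\alpha:[0,a)\to[0,\infty]$ with $\alpha(0)=0$. Minimum relative degree $\underline{m}$ of $b$: the smallest number of differentiations of $b$ along $\dot{\boldsymbol{x}}=f+g\boldsymbol{u}$ after which at least one component of $\boldsymbol{u}$ appears explicitly. Auxiliary construction: fix an integer $1\le m_a\le\underline{m}$. For $i\in\{1,\dots,m_a\}$, let $a_i(t)$ be an auxiliary variable and $\boldsymbol{\pi}_i=(\pi_{i,1},\dots,\pi_{i,m_a+1-i})$ an auxiliary state with $\pi_{i,1}=a_i$, $\dot\pi_{i,j}=\pi_{i,j+1}$ for $j<m_a+1-i$, and $\dot\pi_{i,m_a+1-i}=\nu_i\in\mathbb{R}$ (unbounded auxiliary input); write this as $\dot{\boldsymbol{\pi}}_i=F_i(\boldsymbol{\pi}_i)+G_i(\boldsymbol{\pi}_i)\nu_i$. Augmented systems: $\boldsymbol{z}_i=(\boldsymbol{x},\boldsymbol{\pi}_i)$, $\dot{\boldsymbol{z}}_i=\mathcal{F}_i(\boldsymbol{z}_i)+\mathcal{G}_i(\boldsymbol{z}_i)\boldsymbol{v}_i$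 with $\mathcal{F}_i=(f,F_i)$, $\mathcal{G}_i=\mathrm{diag}(g,G_i)$, $\boldsymbol{v}_i=(\boldsymbol{u},\nu_i)$; $\boldsymbol{Z}=(\boldsymbol{z}_1,\dots,\boldsymbol{z}_{m_a})$, $\boldsymbol{V}=(\boldsymbol{v}_1,\dots,\boldsymbol{v}_{m_a})$. Auxiliary functions $\mathcal{A}_i(\boldsymbol{x},a_i)>0$, each a HOCBF of relative degree $m_a+1-i$ for the $i$-th augmented system: $\varphi_{i,0}=\mathcal{A}_i$, $\varphi_{i,j}=\dot\varphi_{i,j-1}+\alpha_{i,j}(\varphi_{i,j-1})$ ($j=1,\dots,m_a+1-i$, $\alpha_{i,j}$ sufficiently differentiable class $\kappa$), sets $\mathcal{B}_{i,j}=\{\varphi_{i,j}>0\}$ ($j=0,\dots,m_a-i$), and the constraint $\varphi_{i,m_a+1-i}\ge\epsilon$ (fixed $\epsilon>0$) satisfiable on $\mathcal{B}_{i,0}\cap\dots\cap\mathcal{B}_{i,m_a-i}$. $\mathcal{U}_{\boldsymbol{V}}(\boldsymbol{Z})$ is the set of $\boldsymbol{V}$ with $\varphi_{i,m_a+1-i}\ge\epsilon$ for all $i$. AVCBF functions: $\psi_0=\mathcal{A}_1 b(\boldsymbol{x})$, $\psi_i=\mathcal{A}_{i+1}(\dot\psi_{i-1}+\alpha_i(\psi_{i-1}))$ for $i=1,\dots,m_a-1$, $\psi_{m_a}(\boldsymbol{Z},\boldsymbol{V})=\dot\psi_{m_a-1}+\alpha_{m_a}(\psi_{m_a-1})$,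 derivatives along the augmented dynamics, $\alpha_j$ ($j<m_a$) $(m_a-j)$-times differentiable class $\kappa$, $\alpha_{m_a}$ class $\kappa$. $\mathcal{C}_i=\{\boldsymbol{Z}:\psi_i(\boldsymbol{Z})\ge0\}$, $i=0,\dots,m_a-1$. $b$ is an AVCBF if every $\mathcal{A}_i$ is such a HOCBF and $\sup_{\boldsymbol{V}\in\mathcal{U}_{\boldsymbol{V}}(\boldsymbol{Z})}\psi_{m_a}(\boldsymbol{Z},\boldsymbol{V})\ge0$ for all $\boldsymbol{Z}\in\mathcal{C}_0\cap\dots\cap\mathcal{C}_{m_a-1}$. CLF data: $V(\boldsymbol{x})=(\boldsymbol{x}-\boldsymbol{x}_e)^TP(\boldsymbol{x}-\boldsymbol{x}_e)$ with $P$ positive definite, $\boldsymbol{x}_e$ a desired equilibrium, $c_3>0$; $\delta\in\mathbb{R}$ is a relaxation variable; $Q>0$, $W_i>0$, $a_{i,w}\in\mathbb{R}$ are hyperparameters. $L_f,L_g$ denote Lie derivatives. *)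

(* Defs.v *)
From HB Require Import structures.
From mathcomp Require Import all_boot all_order all_algebra.
From mathcomp Require Import all_classical all_reals all_analysis.
Set Implicit Arguments.
Unset Strict Implicit.
Unset Printing Implicit Defensive.
Import Order.TTheory GRing.Theory Num.Theory.
Import numFieldNormedType.Exports.
Local Open Scope ring_scope.
Local Open Scope classical_set_scope.

(* Conventions.
   - R : realType, states x : 'cV[R]_n, controls u : 'cV[R]_q,
     dynamics  xdot = f x + g x *m u  (g x : 'M_(n,q)).
   - m = m_a >= 1.  The families A_i, alpha_i, alpha_{i,j}, W_i, a_{i,w} are
     indexed by nat, 1-based exactly as in the paper (A i = A_i for
     1 <= i <= m); values at other indices are irrelevant.
   - The auxiliary states pi_1,...,pi_m are stored in one square matrix
     P : 'M_(m,m): (0-based) row i-1 holds pi_i, i.e. P (i-1) (j-1) = pi_{i,j}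
     for 1 <= j <= m+1-i.  The remaining entries (i-1)+(j-1) >= m are unused
     padding with zero dynamics; no function depends on them.
   - Global state S = (x, P) (this is Z = (z_1,...,z_m) without the repeated
     copies of x), global input W = (u, nu) with nu : 'cV_m, nu (i-1) = nu_i
     (this is V = (v_1,...,v_m) without the repeated copies of u).
   - Time derivatives "along the (augmented) dynamics" of a function h of the
     state at S under input W are directional derivatives 'D_(Sdot) h S.      *)

Section AVCBF.
Variable R : realType.

Definition state (n m : nat) := ('cV[R]_n * 'M[R]_(m, m))%type.
Definition input (q m : nat) := ('cV[R]_q * 'cV[R]_m)%type.

Definition mget {m : nat} (P : 'M[R]_(m, m)) (i j : nat) : R :=
  match m return 'M[R]_(m, m) -> R with
  | 0 => fun _ => 0
  | k.+1 => fun P => P (inord i) (inord j)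
  end P.

(* dynamics of the integrator chains: pi_{i,j}' = pi_{i,j+1}, last one = nu_i *)
Definition pidot {m : nat} (P : 'M[R]_(m, m)) (nu : 'cV[R]_m) : 'M[R]_(m, m) :=
  \matrix_(i < m, j < m)
    if ((i + j).+1 < m)%N then mget P i j.+1
    else if ((i + j).+1 == m)%N then nu i 0 else 0.

Definition vel {n q m : nat} (f : 'cV[R]_n -> 'cV[R]_n)
  (g : 'cV[R]_n -> 'M[R]_(n, q)) (S : state n m) (W : input q m) : state n m :=
  (f S.1 + g S.1 *m W.1, pidot S.2 W.2).

(* time derivative of h along the augmented dynamics at S under input W,
   i.e. L_F h (S) + L_G h (S) W *)
Definition Ld {n q m : nat} (f : 'cV[R]_n -> 'cV[R]_n) (g : 'cV[R]_n -> 'M[R]_(n, q)) (h : state n m -> R) (S : state n m)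
  (W : input q m) : R := 'D_(vel f g S W) h S.

Definition LF {n q m : nat} (f : 'cV[R]_n -> 'cV[R]_n) (g : 'cV[R]_n -> 'M[R]_(n, q)) (h : state n m -> R) : state n m -> R :=
  fun S => Ld (q:=q) f g h S 0.

Definition iterLF {n q m : nat} (f : 'cV[R]_n -> 'cV[R]_n) (g : 'cV[R]_n -> 'M[R]_(n, q)) (k : nat) (h : state n m -> R) :=
  iter k (LF (q:=q) f g) h.

Definition blift {n m : nat} (b : 'cV[R]_n -> R) : state n m -> R :=
  fun S => b S.1.
Definition Alift {n m : nat} (A : nat -> 'cV[R]_n -> R -> R) (i : nat) :
  state n m -> R := fun S => A i S.1 (mget S.2 i.-1 0).

(* relative degree exactly r (r >= 1) of h w.r.t. the augmented dynamics:
   the first r-1 derivatives are input free, the r-th is not *)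
Definition rel_degree {n q m : nat} (f : 'cV[R]_n -> 'cV[R]_n) (g : 'cV[R]_n -> 'M[R]_(n, q)) (h : state n m -> R) (r : nat) : Prop :=
  (0 < r)%N /\
  (forall k, (k.+1 < r)%N -> forall S (W : input q m),
      Ld f g (iterLF (q:=q) f g k h) S W = iterLF (q:=q) f g k.+1 h S) /\
  (exists S (W : input q m),
      Ld f g (iterLF (q:=q) f g r.-1 h) S W <> iterLF (q:=q) f g r h S).

Definition ma_le_minreldeg {n q m : nat} (f : 'cV[R]_n -> 'cV[R]_n) (g : 'cV[R]_n -> 'M[R]_(n, q)) (b : 'cV[R]_n -> R) : Prop :=
  forall k, (k.+1 < m)%N -> forall S (W : input q m),
    Ld f g (iterLF (q:=q) f g k (blift (m:=m) b)) S W
    = iterLF (q:=q) f g k.+1 (blift (m:=m) b) S.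

Definition classK (alpha : R -> R) : Prop :=
  exists a : \bar R, (0 < a)%E /\ alpha 0 = 0 /\
    {within [set x : R | 0 <= x /\ (x%:E < a)%E], continuous alpha} /\
    (forall x y, 0 <= x -> 0 <= y -> (y%:E < a)%E -> x < y -> alpha x < alpha y).

(* HOCBF functions of A_i: phi_{i,0} = A_i, phi_{i,j} = phi_{i,j-1}' +
   alpha_{i,j}(phi_{i,j-1}) for j < relative degree (input-free part) *)
Fixpoint phiA {n q m : nat} (f : 'cV[R]_n -> 'cV[R]_n) (g : 'cV[R]_n -> 'M[R]_(n, q)) (A : nat -> 'cV[R]_n -> R -> R)
  (alA : nat -> nat -> R -> R) (i j : nat) : state n m -> R :=
  match j with
  | 0 => Alift (m:=m) A i
  | j'.+1 => fun S => LF (q:=q) f g (phiA (q:=q) f g A alA i j') S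
                      + alA i j'.+1 (phiA (q:=q) f g A alA i j' S)
  end.

Definition phiA_top {n q m : nat} (f : 'cV[R]_n -> 'cV[R]_n) (g : 'cV[R]_n -> 'M[R]_(n, q)) A alA (i : nat) (S : state n m)
  (W : input q m) : R :=
  let r := (m.+1 - i)%N in
  Ld f g (phiA (q:=q) f g A alA i r.-1) S W
  + alA i r (phiA (q:=q) f g A alA i r.-1 S).

Definition UV {n q m : nat} (f : 'cV[R]_n -> 'cV[R]_n) (g : 'cV[R]_n -> 'M[R]_(n, q)) A alA (eps : R) (S : state n m) : set (input q m) :=
  [set W | forall i, (1 <= i <= m)%N -> eps <= phiA_top f g A alA i S W].

Definition is_HOCBF_A {n q m : nat} (f : 'cV[R]_n -> 'cV[R]_n) (g : 'cV[R]_n -> 'M[R]_(n, q)) A alA (eps : R) (i : nat) : Prop :=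
  let r := (m.+1 - i)%N in
  (forall x a, 0 < A i x a) /\
  rel_degree f g (Alift (m:=m) A i) r /\
  (forall j, (1 <= j <= r)%N -> classK (alA i j)) /\
  (forall S : state n m, (forall j, (j < r)%N -> 0 < phiA (q:=q) f g A alA i j S) ->
     exists W : input q m, eps <= phiA_top f g A alA i S W).

(* chi k = bracket in psi_k:  chi 0 = b,
   chi k = psi_{k-1}' + alpha_k(psi_{k-1}),  psi_k = A_{k+1} * chi k *)
Fixpoint chi {n q m : nat} (f : 'cV[R]_n -> 'cV[R]_n) (g : 'cV[R]_n -> 'M[R]_(n, q)) (b : 'cV[R]_n -> R) (A : nat -> 'cV[R]_n -> R -> R)
  (al : nat -> R -> R) (k : nat) : state n m -> R :=
  match k with
  | 0 => blift (m:=m) b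
  | k'.+1 => fun S =>
      LF (q:=q) f g (fun S' => Alift (m:=m) A k'.+1 S' * chi (q:=q) f g b A al k' S') S
      + al k'.+1 (Alift (m:=m) A k'.+1 S * chi (q:=q) f g b A al k' S)
  end.

Definition psi {n q m : nat} (f : 'cV[R]_n -> 'cV[R]_n) (g : 'cV[R]_n -> 'M[R]_(n, q)) b A al (k : nat) : state n m -> R :=
  fun S => Alift (m:=m) A k.+1 S * chi (q:=q) f g b A al k S.

Definition psi_top {n q m : nat} (f : 'cV[R]_n -> 'cV[R]_n) (g : 'cV[R]_n -> 'M[R]_(n, q)) b A al (S : state n m) (W : input q m) : R :=
  Ld f g (psi (q:=q) f g b A al m.-1) S W + al m (psi (q:=q) f g b A al m.-1 S).

Definition is_AVCBF {n q m : nat} (f : 'cV[R]_n -> 'cV[R]_n) (g : 'cV[R]_n -> 'M[R]_(n, q)) b A al alA (eps : R) : Prop :=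
  (0 < m)%N /\
  ma_le_minreldeg (q:=q) (m:=m) f g b /\
  (forall i, (1 <= i <= m)%N -> is_HOCBF_A (q:=q) (m:=m) f g A alA eps i) /\
  (forall k, (1 <= k <= m)%N -> classK (al k)) /\
  (forall S : state n m, (forall k, (k < m)%N -> 0 <= psi (q:=q) f g b A al k S) ->
     (0 <= ereal_sup [set (psi_top f g b A al S W)%:E | W in UV f g A alA eps S])%E).

(* B_j^nu : coefficient of nu_j in L_{G_j} L_{F_j}^{m-j} A_j v_j *)
Definition Bnu {n q m : nat} (f : 'cV[R]_n -> 'cV[R]_n) (g : 'cV[R]_n -> 'M[R]_(n, q)) A (j : nat) (S : state n m) : R :=
  let r := (m.+1 - j)%N in
  Ld f g (iterLF (q:=q) f g r.-1 (Alift (m:=m) A j)) S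
     (0, \col_(k < m) (if (k == j.-1 :> nat) then 1 else 0))
  - iterLF (q:=q) f g r (Alift (m:=m) A j) S.

Definition ktimes_derivable (k : nat) (h : R -> R) : Prop :=
  forall l, (l < k)%N -> forall x : R, derivable (derive1n l h) x 1.

Definition Vclf {n : nat} (P : 'M[R]_n) (xe x : 'cV[R]_n) : R :=
  ((x - xe)^T *m P *m (x - xe)) 0 0.

Definition posdef {n : nat} (P : 'M[R]_n) : Prop :=
  P^T = P /\ forall y : 'cV[R]_n, y != 0 -> 0 < (y^T *m P *m y) 0 0.

Definition loc_lipschitz (U V : normedModType R) (h : U -> V) : Prop :=
  forall x, exists2 r : R, 0 < r & exists L : R, forall y z,
    ball x r y -> ball x r z -> `|h y - h z| <= L * `|y - z|.

Definition qp_feasible {n q m : nat} (f : 'cV[R]_n -> 'cV[R]_n) (g : 'cV[R]_n -> 'M[R]_(n, q)) b A al alA (eps : R) (P : 'M[R]_n)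
  (xe : 'cV[R]_n) (c3 : R) (umin umax : 'cV[R]_q) (S : state n m)
  (D : input q m * R) : Prop :=
  let: ((u, nu), delta) := D in
  'D_(f S.1 + g S.1 *m u) (Vclf P xe) S.1 + c3 * Vclf P xe S.1 <= delta /\
  (forall k, umin k 0 <= u k 0 <= umax k 0) /\
  UV f g A alA eps S (u, nu) /\
  0 <= psi_top f g b A al S (u, nu).

Definition qp_cost {q m : nat} (Wt aw : nat -> R) (Q : R) (D : input q m * R) : R :=
  let: ((u, nu), delta) := D in
  \sum_(k < q) (u k 0) ^+ 2
  + \sum_(i < m) Wt i.+1 * (nu i 0 - aw i.+1) ^+ 2
  + Q * delta ^+ 2.

End AVCBF.

(* Main.v *)
(* For fixed [S] every constraint of the program is affine in [(u, nu, delta)].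
   In the HOCBF constraint of [A_i] the only auxiliary input is [nu_i], with
   coefficient [Bnu i > 0]; in the AVCBF constraint [nu_m] has coefficient
   [chi m.-1 * Bnu m], positive because [psi m.-1 = A_m * chi m.-1 > 0].  Hence for
   any admissible [u] one takes the [nu_i] large enough for the HOCBF constraints,
   then increases [nu_m] until the AVCBF constraint holds (the signs of the other
   coefficients are irrelevant), and [delta] absorbs the CLF constraint.  The cost
   is a positive weighted sum of squared distances, so on the nonempty closed convex
   feasible set a minimizer exists by compactness of sublevel sets and is unique by
   strict convexity. *)
Require Import Defs.
From HB Require Import structures.
From mathcomp Require Import all_boot all_order all_algebra.
From mathcomp Require Import all_classical all_reals all_analysis.
From mathcomp Require Import ring lra.
Set Implicit Arguments.
Unset Strict Implicit.
Unset Printing Implicit Defensive.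
Import Order.TTheory GRing.Theory Num.Theory.
Import numFieldNormedType.Exports.
Local Open Scope ring_scope.
Local Open Scope classical_set_scope.

(** * Affine functions and the closed midpoint-convex sets they cut out *)

(** Equivalent to linearity of [h - h 0], in the shape of [linear] so that the two rewrite
    together. *)
Definition affine {R : realType} {E : lmodType R} (h : E -> R) : Prop :=
  forall (a : R) (x y : E), h (a *: x + y) = a * (h x - h 0) + h y.

Lemma affine_comp_linear (R : realType) (E E' : lmodType R) (l : E -> E')
  (h : E' -> R) : linear l -> affine h -> affine (h \o l).
Proof.
move=> lP hA a x y; have l0 : l 0 = 0.
  by rewrite -(addNr 0) -scaleN1r lP scaleN1r addNr.
by rewrite /= lP l0 hA.
Qed.

Lemma affine_midpoint (R : realType) (E : lmodType R) (h : E -> R) (x y : E) :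
  affine h -> h (2^-1 *: (x + y)) = 2^-1 * (h x + h y).
Proof.
move=> hA; rewrite scalerDr hA.
have := hA (2^-1) y 0; rewrite addr0 => ->.
by lra.
Qed.

Lemma affine_sum (R : realType) (E : lmodType R) (h : E -> R) (I : Type)
  (r : seq I) (a : I -> R) (x : I -> E) : affine h ->
  h (\sum_(i <- r) a i *: x i) = \sum_(i <- r) a i * (h (x i) - h 0) + h 0.
Proof.
move=> hA; elim: r => [|i r IHr]; first by rewrite !big_nil add0r.
by rewrite !big_cons hA IHr addrA.
Qed.

Lemma continuous_sum (R : realType) (T : topologicalType) (I : Type) (r : seq I)
  (h : I -> T -> R) :
  (forall i, continuous (h i)) -> continuous (fun x => \sum_(i <- r) h i x).
Proof.
move=> hC; by apply: continuous_big => //; exact: add_continuous.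
Qed.

Lemma affine_rV_continuous (R : realType) (N : nat) (h : 'rV[R]_N -> R) :
  affine h -> continuous h.
Proof.
move=> hA.
have -> : h = fun v => \sum_i v 0 i * (h (delta_mx 0 i) - h 0) + h 0.
  by apply/funext => v; rewrite {1}(row_sum_delta v) affine_sum.
move=> v; apply: continuousD; last exact: cst_continuous.
apply: continuous_sum => i u.
apply: (@continuousM R 'rV[R]_N (fun x => x 0 i) (fun=> _) u); last exact: cst_continuous.
exact: coord_continuous.
Qed.

(** For closed sets this amounts to convexity; the midpoint is the only convex combination that the
    uniqueness argument takes. *)
Definition closed_midconvex {R : realType} {N : nat} (F : set 'rV[R]_N) : Prop :=
  closed F /\ forall x y, F x -> F y -> F (2^-1 *: (x + y)).

Lemma closed_midconvex_halfspace (R : realType) (N : nat) (h : 'rV[R]_N -> R) :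
  affine h -> closed_midconvex [set v | 0 <= h v].
Proof.
move=> hA; split.
  apply: (@preimage_closed _ _ h [set x | 0 <= x]); last exact: closed_ge.
  by move=> v _; exact: affine_rV_continuous.
by move=> x y /= hx hy; rewrite affine_midpoint // mulr_ge0 ?addr_ge0 ?invr_ge0.
Qed.

Lemma closed_midconvexI (R : realType) (N : nat) (F G : set 'rV[R]_N) :
  closed_midconvex F -> closed_midconvex G -> closed_midconvex (F `&` G).
Proof.
move=> [cF mF] [cG mG]; split; first exact: closedI.
by move=> x y [Fx Gx] [Fy Gy]; split; [exact: mF|exact: mG].
Qed.

Lemma closed_midconvex_bigcap (R : realType) (N : nat) (I : Type) (D : set I)
  (F : I -> set 'rV[R]_N) : (forall i, D i -> closed_midconvex (F i)) ->
  closed_midconvex (\bigcap_(i in D) F i).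
Proof.
move=> FP; split; first by apply: closed_bigI => i /FP[].
by move=> x y Fx Fy i Di; apply: (FP i Di).2; [exact: Fx|exact: Fy].
Qed.

(** * Weighted least squares over a closed midpoint-convex set *)

Section WeightedLeastSquares.
Context (R : realType) (N : nat) (w c : 'I_N -> R).
Hypothesis w_gt0 : forall i, 0 < w i.

Definition wsq (v : 'rV[R]_N) : R := \sum_i w i * (v 0 i - c i) ^+ 2.

Lemma wsq_continuous : continuous wsq.
Proof.
apply: continuous_sum => i v.
apply: (@continuousM R 'rV[R]_N (fun=> w i) (fun x => (x 0 i - c i) ^+ 2) v); first exact: cst_continuous.
have h : {for v, continuous (fun x : 'rV[R]_N => x 0 i - c i)}.
  by apply: continuousB; [exact: coord_continuous|exact: cst_continuous].
exact: (continuousM h h).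
Qed.

(** Bounds sublevel sets coordinatewise; [t <= 1 + t ^+ 2] stands in for a square root. *)
Lemma wsq_coord_le (v : 'rV[R]_N) i C : wsq v <= C -> `|v 0 i - c i| <= 1 + C / w i.
Proof.
move=> vC.
have : w i * (v 0 i - c i) ^+ 2 <= C.
  apply: le_trans vC; rewrite /wsq (bigD1 i) //= lerDl.
  by apply: sumr_ge0 => j _; rewrite mulr_ge0 ?sqr_ge0 // ltW.
rewrite mulrC -ler_pdivlMr // -real_normK ?num_real //.
move: (`|_|) (normr_ge0 (v 0 i - c i)) (C / w i) => t t0 x; nra.
Qed.

(** Parallelogram identity: the subtracted sum measures strict convexity. *)
Lemma wsq_midpoint (x y : 'rV[R]_N) :
  wsq (2^-1 *: (x + y))
  = 2^-1 * (wsq x + wsq y) - 4^-1 * \sum_i w i * (x 0 i - y 0 i) ^+ 2.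
Proof.
rewrite /wsq -big_split /= !mulr_sumr -sumrB; apply: eq_bigr => i _.
by rewrite !mxE; field.
Qed.

Lemma wsq_unique_minimizer (F : set 'rV[R]_N) :
  closed_midconvex F -> F !=set0 ->
  exists! x, F x /\ forall y, F y -> wsq x <= wsq y.
Proof.
move=> [cF mF] [v0 Fv0].
(* The box [K] contains the sublevel set of [v0], by [wsq_coord_le]. *)
pose M i := 1 + wsq v0 / w i.
pose K := [set v : 'rV[R]_N | forall i, `[c i - M i, c i + M i]%classic (v ord0 i)].
have KP v : wsq v <= wsq v0 -> K v.
  move=> /wsq_coord_le vC i; have := vC i.
  by rewrite ler_distl /= in_itv.
have cK : compact (K `&` F).
  apply: compact_closedI cF.
  apply: (@rV_compact _ N (fun i => `[c i - M i, c i + M i]%classic)) => i.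
  exact: segment_compact.
have K0 : K `&` F !=set0 by exists v0; split => //; exact: KP.
have wsqK : {within K `&` F, continuous wsq}.
  exact: continuous_subspaceT wsq_continuous.
have [x] := EVT_min_rV K0 cK wsqK.
rewrite inE => -[Kx Fx] xmin.
have {}xmin y : F y -> wsq x <= wsq y.
  (* Points of [F] above level [wsq v0] are beaten by [v0], which lies in [K]. *)
  move=> Fy; have [yv|/ltW vy] := leP (wsq y) (wsq v0).
    by apply: xmin; rewrite inE; split => //; exact: KP.
  apply: le_trans vy; apply: xmin; rewrite inE; split => //.
  exact: KP.
exists x; split => // y [Fy ymin]; apply/rowP => i.
(* The midpoint is in [F] and [x], [y] are both minimal, so the term subtracted in [wsq_midpoint]
   must vanish. *)
have := xmin _ (mF _ _ Fx Fy); rewrite wsq_midpoint => h.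
have {}ymin := ymin _ Fx.
have s0 j : 0 <= w j * (x 0 j - y 0 j) ^+ 2 by rewrite mulr_ge0 ?sqr_ge0 // ltW.
have : \sum_j w j * (x 0 j - y 0 j) ^+ 2 == 0.
  rewrite eq_le sumr_ge0 ?andbT //; lra.
rewrite psumr_eq0 // => /allP /(_ i); rewrite mem_index_enum => /(_ isT) /=.
by rewrite mulf_eq0 gt_eqF //= sqrf_eq0 subr_eq0 => /eqP.
Qed.

End WeightedLeastSquares.

(** * Dependence of time derivatives on the input *)

(** The input part of [vel]: at zero auxiliary state [pidot] keeps only the inputs, on the
    antidiagonal where the chains end. *)
Definition ctl {R : realType} {n q m : nat} (g : 'cV[R]_n -> 'M[R]_(n, q))
  (S : state R n m) (W : input R q m) : state R n m :=
  (g S.1 *m W.1, pidot 0 W.2).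

Lemma mget0 (R : realType) (m i j : nat) : mget (0 : 'M[R]_m) i j = 0.
Proof. by case: m => // m; rewrite /= mxE. Qed.

Lemma ctl_linear (R : realType) (n q m : nat) (g : 'cV[R]_n -> 'M[R]_(n, q))
  (S : state R n m) : linear (ctl g S).
Proof.
move=> a [u nu] [u' nu']; congr pair; rewrite /=.
  by rewrite linearP.
apply/matrixP => i j; rewrite !mxE mget0.
by case: ifP; [rewrite mulr0 addr0|case: ifP; rewrite // mulr0 addr0].
Qed.

Lemma vel_ctl (R : realType) (n q m : nat) (f : 'cV[R]_n -> 'cV[R]_n)
  (g : 'cV[R]_n -> 'M[R]_(n, q)) (S : state R n m) (W : input R q m) :
  vel f g S W = vel f g S 0 + ctl g S W.
Proof.
congr pair; rewrite /=; first by rewrite mulmx0 addr0.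
apply/matrixP => i j; rewrite !mxE mget0.
by case: ifP => _; [rewrite addr0|case: ifP; rewrite add0r].
Qed.

Lemma Ld_ctl (R : realType) (n q m : nat) (f : 'cV[R]_n -> 'cV[R]_n)
  (g : 'cV[R]_n -> 'M[R]_(n, q)) (h : state R n m -> R) (S : state R n m)
  (W : input R q m) : differentiable h S ->
  Ld f g h S W = LF (q:=q) f g h S + 'D_(ctl g S W) h S.
Proof.
by move=> dh; rewrite /LF /Ld !deriveE // vel_ctl linearD.
Qed.

Lemma Ld_affine (R : realType) (n q m : nat) (f : 'cV[R]_n -> 'cV[R]_n)
  (g : 'cV[R]_n -> 'M[R]_(n, q)) (h : state R n m -> R) (S : state R n m) (c : R) :
  differentiable h S -> affine (fun W : input R q m => Ld f g h S W + c).
Proof.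
move=> dh a W W'; rewrite -[Ld f g h S 0]/(LF f g h S) !Ld_ctl // !deriveE //.
rewrite ctl_linear linearP /=.
rewrite -[_ *: _]/(a * _); ring.
Qed.

(** * Which auxiliary states each function involves *)

(* [S] and [S'] have the same [x] and the same auxiliary entries at the (0-based)
   positions selected by [Q]. *)
Definition agree {R : realType} {n m : nat} (Q : nat -> nat -> bool)
  (S S' : state R n m) : Prop :=
  S.1 = S'.1 /\ forall i j : 'I_m, Q i j -> S.2 i j = S'.2 i j.

Definition depends_on {R : realType} {n m : nat} (Q : nat -> nat -> bool)
  (h : state R n m -> R) : Prop := forall S S', agree Q S S' -> h S = h S'.

Lemma agreeW (R : realType) (n m : nat) (Q Q' : nat -> nat -> bool)
  (S S' : state R n m) :
  (forall i j, Q i j -> Q' i j) -> agree Q' S S' -> agree Q S S'.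
Proof. by move=> QQ' [e1 e2]; split => // i j /QQ'; exact: e2. Qed.

Lemma agree_mget (R : realType) (n m : nat) (Q : nat -> nat -> bool)
  (S S' : state R n m) (i j : nat) : (i < m)%N -> (j < m)%N ->
  agree Q S S' -> Q i j -> mget S.2 i j = mget S'.2 i j.
Proof.
case: m S S' => // m S S' im jm [_ e2] Qij.
by rewrite /mget; apply: e2; rewrite !inordK.
Qed.

(** The difference quotients already coincide for every [t], because [S + t v] and [S' + t v'] agree
    on [Q]. *)
Lemma derive_agree (R : realType) (n m : nat) (Q : nat -> nat -> bool)
  (h : state R n m -> R) (S S' v v' : state R n m) :
  depends_on Q h -> agree Q S S' -> agree Q v v' -> 'D_v h S = 'D_v' h S'.
Proof.
move=> hQ SS' vv'.
suff E : (fun t : R => t^-1 *: ((h \o shift S) (t *: v) - h S))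
       = (fun t : R => t^-1 *: ((h \o shift S') (t *: v') - h S')).
  by rewrite /derive E.
apply/funext => t; rewrite (hQ _ _ SS'); congr (_ *: (_ - _)).
apply: hQ; case: SS' vv' => [e1 e2] [e1' e2']; split => /=; first by rewrite e1 e1'.
by move=> i j Qij; rewrite !mxE e2 // e2'.
Qed.

(** The drift of entry [(i, j)] is entry [(i, j.+1)], so each Lie derivative reads one column
    further in the same row. *)
Lemma LF_depends_on (R : realType) (n q m : nat) (f : 'cV[R]_n -> 'cV[R]_n)
  (g : 'cV[R]_n -> 'M[R]_(n, q)) (Q Q' : nat -> nat -> bool)
  (h : state R n m -> R) :
  (forall i j, Q i j -> Q' i j /\ Q' i j.+1) ->
  depends_on Q h -> depends_on Q' (LF (q:=q) f g h).
Proof.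
move=> QQ' hQ S S' SS'; apply: (derive_agree hQ).
  by apply: agreeW SS' => i j /QQ'[].
split; rewrite /=; first by rewrite SS'.1.
move=> i j /QQ'[_ Qij]; rewrite !mxE; case: ifP => // ijm.
apply: (agree_mget _ _ SS' Qij) => //.
by apply: leq_ltn_trans ijm; rewrite -addnS leq_addl.
Qed.

Lemma Alift_depends_on (R : realType) (n m : nat) (A : nat -> 'cV[R]_n -> R -> R)
  (i : nat) (Q : nat -> nat -> bool) : (1 <= i <= m)%N -> Q i.-1 0%N ->
  depends_on Q (Alift (m:=m) A i).
Proof.
case: i => // i im Qi S S' SS'; rewrite /Alift SS'.1; congr A.
by apply: (agree_mget _ _ SS' Qi) => //; exact: leq_ltn_trans im.
Qed.

Lemma phiA_depends_on (R : realType) (n q m : nat) (f : 'cV[R]_n -> 'cV[R]_n)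
  (g : 'cV[R]_n -> 'M[R]_(n, q)) A alA (i j : nat) : (1 <= i <= m)%N ->
  depends_on (fun k l => (k == i.-1) && (l <= j)%N)
    (phiA (q:=q) (m:=m) f g A alA i j).
Proof.
move=> im; elim: j => [|j IHj]; first by apply: Alift_depends_on => //; rewrite eqxx.
move=> S S' SS' /=; congr (_ + alA _ _ _).
  apply: (LF_depends_on _ _ _ IHj SS') => k l /andP[-> /= lj]; split => //.
  exact: leqW.
by apply: IHj; apply: (agreeW _ SS') => k l /andP[-> /leqW].
Qed.

(* The first term of [phiA i j] is the [j]-th Lie derivative of [A_i]; the
   remainder only involves [pi_{i,1}, ..., pi_{i,j}], one entry less than
   [phiA i j] itself, so both have the same coefficient on [nu_i]. *)
Lemma phiA_remainder_depends_on (R : realType) (n q m : nat)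
  (f : 'cV[R]_n -> 'cV[R]_n) (g : 'cV[R]_n -> 'M[R]_(n, q)) A alA (i j : nat) :
  (1 <= i <= m)%N ->
  (forall k (S : state R n m), (k < j)%N ->
     differentiable (iterLF (q:=q) f g k (Alift (m:=m) A i)) S) ->
  (forall k (S : state R n m), (k < j)%N ->
     differentiable (phiA (q:=q) f g A alA i k) S) ->
  depends_on (fun k l => (k == i.-1) && (l < j)%N)
    (phiA (q:=q) (m:=m) f g A alA i j - iterLF (q:=q) f g j (Alift (m:=m) A i)).
Proof.
move=> im; elim: j => [|j IHj] dL dphi S S' SS'.
  by rewrite /= [LHS]subrr [RHS]subrr.
have LFB T : LF (q:=q) f g (phiA (q:=q) f g A alA i j) T
    - LF (q:=q) f g (iterLF (q:=q) f g j (Alift (m:=m) A i)) T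
    = LF (q:=q) f g (phiA (q:=q) f g A alA i j
         - iterLF (q:=q) f g j (Alift (m:=m) A i)) T.
  by rewrite /LF /Ld deriveB //; apply: diff_derivable; [exact: dphi|exact: dL].
have step T : (phiA (q:=q) f g A alA i j.+1
    - iterLF (q:=q) f g j.+1 (Alift (m:=m) A i)) T
  = LF (q:=q) f g (phiA (q:=q) f g A alA i j
         - iterLF (q:=q) f g j (Alift (m:=m) A i)) T
    + alA i j.+1 (phiA (q:=q) f g A alA i j T).
  by rewrite -LFB [LHS]addrAC.
rewrite !step; congr (_ + alA _ _ _).
  apply: (LF_depends_on _ _ _ _ SS'); last first.
    by apply: IHj => k T kj; [apply: dL|apply: dphi]; exact: leqW.
  by move=> k l /andP[-> /= lj]; split => //; exact: leqW.
apply: (phiA_depends_on f g A alA (j := j) im) => //.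
Qed.

(** Multiplying by A_{k+1} adds the 0-based row [k]; differentiating along the drift adds columns
    but no rows. *)
Lemma chi_depends_on (R : realType) (n q m : nat) (f : 'cV[R]_n -> 'cV[R]_n)
  (g : 'cV[R]_n -> 'M[R]_(n, q)) b A al (k : nat) : (k <= m)%N ->
  depends_on (fun i _ => (i < k)%N) (chi (q:=q) (m:=m) f g b A al k).
Proof.
elim: k => [_ S S' SS'|k IHk km S S' SS']; first by rewrite /= /blift SS'.1.
have psiP : depends_on (fun i _ => (i < k.+1)%N)
    (fun S => Alift (m:=m) A k.+1 S * chi (q:=q) f g b A al k S).
  move=> T T' TT'; congr (_ * _); first exact: Alift_depends_on TT'.
  by apply: (IHk (ltnW km)); apply: (agreeW _ TT') => i _ /leqW.
rewrite /=; congr (_ + al _ _); last exact: psiP.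
exact: (LF_depends_on _ _ _ psiP SS').
Qed.

(** * Coefficients of the auxiliary inputs in the constraints *)

Lemma derive_add_dir (R : realType) (V : normedModType R) (h : V -> R) (x v w : V) :
  differentiable h x -> 'D_(v + w) h x = 'D_v h x + 'D_w h x.
Proof. by move=> dh; rewrite !deriveE // linearD. Qed.

Lemma derive_scale_dir (R : realType) (V : normedModType R) (h : V -> R) (x v : V)
  (t : R) : differentiable h x -> 'D_(t *: v) h x = t * 'D_v h x.
Proof. by move=> dh; rewrite !deriveE // linearZ. Qed.

(** Unit vector with 1-based index [j], spelled as in [Bnu] so that the two match by conversion. *)
Definition nu1 {R : realType} {m : nat} (j : nat) : 'cV[R]_m :=
  \col_(k < m) (if (k == j.-1 :> nat) then 1 else 0).

Lemma ctlZ (R : realType) (n q m : nat) (g : 'cV[R]_n -> 'M[R]_(n, q))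
  (S : state R n m) (t : R) (W : input R q m) :
  ctl g S (t *: W) = t *: ctl g S W.
Proof.
have ctl0 : ctl g S 0 = 0.
  by rewrite -(addNr 0) -scaleN1r ctl_linear scaleN1r addNr.
by have := ctl_linear g S t W 0; rewrite ctl0 !addr0.
Qed.

Lemma Ld_addnu (R : realType) (n q m : nat) (f : 'cV[R]_n -> 'cV[R]_n)
  (g : 'cV[R]_n -> 'M[R]_(n, q)) (h : state R n m -> R) (S : state R n m)
  (u : 'cV[R]_q) (nu nu' : 'cV[R]_m) : differentiable h S ->
  Ld f g h S (u, nu + nu') = Ld f g h S (u, nu) + 'D_(ctl g S (0, nu')) h S.
Proof.
move=> dh; have ctlD : ctl g S (u, nu + nu') = ctl g S (u, nu) + ctl g S (0, nu').
  have -> : (u, nu + nu') = 1 *: (0, nu') + (u, nu) :> input R q m.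
    by rewrite scale1r; congr pair => /=; rewrite ?add0r // addrC.
  by rewrite ctl_linear scale1r addrC.
rewrite (Ld_ctl f g (u, nu + nu') dh) (Ld_ctl f g (u, nu) dh) ctlD.
by rewrite (derive_add_dir _ _ dh) addrA.
Qed.

Lemma BnuE (R : realType) (n q m : nat) (f : 'cV[R]_n -> 'cV[R]_n)
  (g : 'cV[R]_n -> 'M[R]_(n, q)) A (j : nat) (S : state R n m) : (j <= m)%N ->
  differentiable (iterLF (q:=q) f g (m - j) (Alift (m:=m) A j)) S ->
  Bnu f g A j S
  = 'D_(ctl g S (0, nu1 j)) (iterLF (q:=q) f g (m - j) (Alift (m:=m) A j)) S.
Proof. by move=> jm dL; rewrite /Bnu subSn //= Ld_ctl // addrC addKr. Qed.

Lemma phiA_nu (R : realType) (n q m : nat) (f : 'cV[R]_n -> 'cV[R]_n)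
  (g : 'cV[R]_n -> 'M[R]_(n, q)) A alA (i : 'I_m) (S : state R n m) (nu : 'cV[R]_m) :
  (forall k (T : state R n m), (k <= m - i.+1)%N ->
     differentiable (iterLF (q:=q) f g k (Alift (m:=m) A i.+1)) T) ->
  (forall k (T : state R n m), (k <= m - i.+1)%N ->
     differentiable (phiA (q:=q) f g A alA i.+1 k) T) ->
  'D_(ctl g S (0, nu)) (phiA (q:=q) f g A alA i.+1 (m - i.+1)) S
  = nu i 0 * Bnu (q:=q) f g A i.+1 S.
Proof.
move=> dL dphi; have im : (1 <= i.+1 <= m)%N by rewrite /= ltn_ord.
have -> : 'D_(ctl g S (0, nu)) (phiA (q:=q) f g A alA i.+1 (m - i.+1)) S
    = 'D_(ctl g S (nu i 0 *: (0, nu1 i.+1))) (phiA (q:=q) f g A alA i.+1 (m - i.+1)) S.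
  apply: (derive_agree (phiA_depends_on f g A alA im)) => //.
  split=> [|k l /andP[/eqP ki _]]; rewrite /= ?scaler0 // !mxE mget0.
  by rewrite ki eqxx mulr1; have -> : k = i by exact: val_inj.
rewrite ctlZ BnuE //; last exact: dL.
have dphiS := dphi _ S (leqnn _); have dLS := dL _ S (leqnn _).
rewrite derive_scale_dir //; congr (_ * _).
(* It remains to see that the remainder is blind to [nu_i]: that input enters at column [m - i.+1],
   while the remainder reads columns strictly below. *)
apply/eqP; rewrite -subr_eq0 -deriveB; [|exact: diff_derivable..].
have rP := @phiA_remainder_depends_on R n q m f g A alA i.+1 (m - i.+1) im
  (fun k T km => dL k T (ltnW km)) (fun k T km => dphi k T (ltnW km)).
rewrite (derive_agree (S' := S) (v' := 0) rP) //.
  by rewrite deriveE ?linear0 //; exact: differentiableB.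
split=> [|k l /andP[/eqP ki lm]]; rewrite /= ?mulmx0 // !mxE mget0.
have kl : ((k + l).+1 < m)%N by rewrite ki /= -addSn -ltn_subRL.
by rewrite kl.
Qed.

Lemma phiA_top_nu (R : realType) (n q m : nat) (f : 'cV[R]_n -> 'cV[R]_n)
  (g : 'cV[R]_n -> 'M[R]_(n, q)) A alA (i : 'I_m) (S : state R n m)
  (u : 'cV[R]_q) (nu : 'cV[R]_m) :
  (forall k (T : state R n m), (k <= m - i.+1)%N ->
     differentiable (iterLF (q:=q) f g k (Alift (m:=m) A i.+1)) T) ->
  (forall k (T : state R n m), (k <= m - i.+1)%N ->
     differentiable (phiA (q:=q) f g A alA i.+1 k) T) ->
  phiA_top f g A alA i.+1 S (u, nu)
  = phiA_top f g A alA i.+1 S (u, 0) + nu i 0 * Bnu (q:=q) f g A i.+1 S.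
Proof.
move=> dL dphi; rewrite -(phiA_nu _ _ dL dphi).
rewrite /phiA_top subSn ?ltn_ord //= -[in LHS](add0r nu) Ld_addnu; last exact: dphi.
by rewrite addrAC.
Qed.

(* [chi m.-1] does not involve [pi_m], so by the product rule the coefficient of
   [nu_m] in [psi_top] is that of [A_m] scaled by [chi m.-1]. *)
Lemma psi_top_nu (R : realType) (n q m : nat) (f : 'cV[R]_n -> 'cV[R]_n)
  (g : 'cV[R]_n -> 'M[R]_(n, q)) b A al (S : state R n m)
  (u : 'cV[R]_q) (nu : 'cV[R]_m) (t : R) : (0 < m)%N ->
  differentiable (Alift (m:=m) A m) S ->
  differentiable (chi (q:=q) (m:=m) f g b A al m.-1) S ->
  psi_top f g b A al S (u, nu + t *: nu1 m)
  = psi_top f g b A al S (u, nu)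
    + t * (chi (q:=q) f g b A al m.-1 S * Bnu (q:=q) f g A m S).
Proof.
move=> m0 dA dchi.
have psiE : psi (q:=q) (m:=m) f g b A al m.-1
    = Alift (m:=m) A m * chi (q:=q) f g b A al m.-1.
  by apply/funext => T; rewrite /psi prednK.
have dpsi : differentiable (psi (q:=q) (m:=m) f g b A al m.-1) S.
  by rewrite psiE; exact: differentiableM.
rewrite /psi_top Ld_addnu // addrAC; congr (_ + _).
have -> : (0, t *: nu1 m) = t *: (0, nu1 m) :> input R q m.
  by congr pair; rewrite scaler0.
rewrite ctlZ derive_scale_dir //; congr (_ * _).
rewrite psiE deriveM; [|exact: diff_derivable..].
have -> : 'D_(ctl g S (0, nu1 m)) (chi (q:=q) f g b A al m.-1) S = 0.
  rewrite (derive_agree (S' := S) (v' := 0) (chi_depends_on f g b A al (leq_pred m))) //.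
    by rewrite deriveE // linear0.
  split=> [|k l km]; rewrite /= ?mulmx0 // !mxE mget0.
  by case: ifP => // _; case: ifP => // _; rewrite ltn_eqF.
by rewrite BnuE ?subnn // scaler0 add0r.
Qed.

(** * Admissible auxiliary inputs for a given control *)

Lemma exists_admissible_nu (R : realType) (n q m : nat) (f : 'cV[R]_n -> 'cV[R]_n)
  (g : 'cV[R]_n -> 'M[R]_(n, q)) b A al alA (eps : R) (S : state R n m)
  (u : 'cV[R]_q) : (0 < m)%N ->
  (forall i k (T : state R n m), (1 <= i <= m)%N -> (k <= m - i)%N ->
     differentiable (iterLF (q:=q) f g k (Alift (m:=m) A i)) T) ->
  (forall i j (T : state R n m), (1 <= i <= m)%N -> (j <= m - i)%N ->
     differentiable (phiA (q:=q) f g A alA i j) T) ->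
  differentiable (chi (q:=q) (m:=m) f g b A al m.-1) S ->
  (forall j, (1 <= j <= m)%N -> 0 < Bnu (q:=q) f g A j S) ->
  0 < chi (q:=q) f g b A al m.-1 S ->
  exists nu, UV f g A alA eps S (u, nu) /\ 0 <= psi_top f g b A al S (u, nu).
Proof.
move=> m0 dL dphi dchi B0 chi0.
(* With [nu0] every HOCBF constraint holds with equality to [eps]. *)
pose nu0 : 'cV[R]_m :=
  \col_i ((eps - phiA_top f g A alA i.+1 S (u, 0)) / Bnu (q:=q) f g A i.+1 S).
pose c := chi (q:=q) f g b A al m.-1 S * Bnu (q:=q) f g A m S.
have c0 : 0 < c by rewrite mulr_gt0 // B0 // m0 leqnn.
(* Chosen so that [t * c] is the absolute value of [psi_top] at [nu0], enough to offset a negative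
   value. *)
pose t := `|psi_top f g b A al S (u, nu0)| / c.
have t0 : 0 <= t by rewrite divr_ge0 // ltW.
exists (nu0 + t *: nu1 m); split.
  case=> // i im; rewrite -[i]/(nat_of_ord (Ordinal (im : (i < m)%N))).
  set k := Ordinal _; have km : (1 <= k.+1 <= m)%N := im.
  have Bk := B0 _ km.
  rewrite phiA_top_nu; [|by move=> *; apply: dL|by move=> *; apply: dphi].
  (* The added multiple of [nu1 m] has nonnegative entries and [Bnu] is positive, so no HOCBF
     constraint is lost. *)
  rewrite -lerBlDl -ler_pdivrMr // 3!mxE lerDl mulr_ge0 // !mxE.
  by case: ifP.
rewrite psi_top_nu //; last by apply: (dL m 0%N) => //; rewrite m0 leqnn.
by rewrite -/c divfK ?gt_eqF // addrC -lerBlDr sub0r -normrN ler_norm.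
Qed.

(** * The program as least squares on row vectors *)

Lemma differentiable_Vclf (R : realType) (n : nat) (P : 'M[R]_n) (xe x : 'cV[R]_n) :
  differentiable (Vclf P xe) x.
Proof.
pose dx i : 'cV[R]_n -> R := (fun y : 'cV[R]_n => y i 0) - cst (xe i 0).
(* Expanded as a polynomial in the coordinates, so that sum and product rules apply. *)
have -> : Vclf P xe = \sum_(j < n) (\sum_(i < n) dx i * cst (P i j)) * dx j.
  apply/funext => y; rewrite fct_sumE /Vclf mxE; apply: eq_bigr => j _.
  transitivity ((\sum_(i < n) dx i * cst (P i j)) y * dx j y) => //.
  rewrite !mxE fct_sumE; congr (_ * _).
  by apply: eq_bigr => i _; rewrite !mxE.
have dc i : differentiable (dx i) x.
  by apply: differentiableB => //; exact: differentiable_coord.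
apply: differentiable_sum => j; apply: differentiableM => //.
by apply: differentiable_sum => i; exact: differentiableM.
Qed.

(** Flattens [(u, nu, delta)] into one row, the space in which the minimizer is constructed. *)
Definition dec {R : realType} {q m : nat} (v : 'rV[R]_(q + (m + 1))) : input R q m * R :=
  ((\col_k v 0 (lshift (m + 1) k), \col_i v 0 (rshift q (lshift 1 i))),
   v 0 (rshift q (rshift m 0))).

Definition enc {R : realType} {q m : nat} (D : input R q m * R) : 'rV[R]_(q + (m + 1)) :=
  row_mx D.1.1^T (row_mx D.1.2^T D.2%:M).

Lemma encK (R : realType) (q m : nat) : cancel (@enc R q m) dec.
Proof.
move=> [[u nu] d]; rewrite /enc /dec /= !row_mxEr mxE; congr (_, _, _).
- by apply/colP => k; rewrite mxE row_mxEl mxE.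
- by apply/colP => i; rewrite mxE row_mxEr row_mxEl mxE.
Qed.

Lemma decK (R : realType) (q m : nat) : cancel (@dec R q m) enc.
Proof.
move=> v; apply/rowP => k; case: (split_ordP k) => [i|{}k] ->.
  by rewrite row_mxEl !mxE.
rewrite row_mxEr; case: (split_ordP k) => i ->; first by rewrite row_mxEl !mxE.
by rewrite row_mxEr (ord1 i) mxE.
Qed.

Lemma dec_linear (R : realType) (q m : nat) : linear (@dec R q m).
Proof.
move=> a x y; rewrite /dec !mxE; congr (_, _, _).
  by apply/colP => k; rewrite !mxE.
by apply/colP => k; rewrite !mxE.
Qed.

(** Weights and centre are themselves encoded triples: [(1, Wt, Q)] and [(0, aw, 0)]. *)
Lemma qp_cost_dec (R : realType) (q m : nat) (Wt aw : nat -> R) (Q : R)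
  (v : 'rV[R]_(q + (m + 1))) :
  qp_cost Wt aw Q (dec v)
  = wsq (fun k => enc (const_mx 1, \col_(i < m) Wt i.+1, Q) 0 k)
        (fun k => enc (0, \col_(i < m) aw i.+1, 0) 0 k) v.
Proof.
rewrite /wsq /= big_split_ord /= big_split_ord /= big_ord1 -addrA.
congr (_ + (_ + _)).
- by apply: eq_bigr => k _; rewrite /enc !row_mxEl !mxE mul1r subr0.
- by apply: eq_bigr => k _; rewrite /enc !row_mxEr !row_mxEl !mxE.
- by rewrite /enc !row_mxEr !mxE subr0.
Qed.

Lemma Ld_input_affine (R : realType) (n q m : nat) (f : 'cV[R]_n -> 'cV[R]_n)
  (g : 'cV[R]_n -> 'M[R]_(n, q)) (h : state R n m -> R) (S : state R n m) (c : R) :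
  differentiable h S ->
  affine (fun D : input R q m * R => Ld f g h S D.1 + c).
Proof. by move=> dh a D D'; exact: (Ld_affine f g c dh a D.1 D'.1). Qed.

Lemma clf_slack_affine (R : realType) (n q m : nat) (f : 'cV[R]_n -> 'cV[R]_n)
  (g : 'cV[R]_n -> 'M[R]_(n, q)) (V : 'cV[R]_n -> R) (x : 'cV[R]_n) (c : R) :
  differentiable V x ->
  affine (fun D : input R q m * R => D.2 - ('D_(f x + g x *m D.1.1) V x + c)).
Proof.
move=> dV a D D'; rewrite /= !derive_add_dir // mulmx0.
rewrite mulmxDr -scalemxAr derive_add_dir // derive_scale_dir //.
have -> : 'D_0 V x = 0 by rewrite deriveE // linear0.
rewrite -[a *: D.2]/(a * D.2).
move: ('D_(f x) V x) ('D__ V x) ('D__ V x) D.2 D'.2 => r s s' d d'; ring.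
Qed.

Lemma qp_feasible_closed_midconvex (R : realType) (n q m : nat)
  (f : 'cV[R]_n -> 'cV[R]_n) (g : 'cV[R]_n -> 'M[R]_(n, q)) b A al alA (eps : R)
  (P : 'M[R]_n) (xe : 'cV[R]_n) (c3 : R) (umin umax : 'cV[R]_q) (S : state R n m) :
  (forall i, (1 <= i <= m)%N ->
     differentiable (phiA (q:=q) f g A alA i (m - i)) S) ->
  differentiable (psi (q:=q) (m:=m) f g b A al m.-1) S ->
  closed_midconvex (dec @^-1` [set D | qp_feasible f g b A al alA eps P xe c3 umin umax S D]).
Proof.
move=> dphi dpsi.
pose H (h : input R q m * R -> R) := [set v : 'rV_(q + (m + 1)) | 0 <= h (dec v)].
have HP h : affine h -> closed_midconvex (H h).
  move=> hA; have hdec := affine_comp_linear (@dec_linear R q m) hA.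
  exact: (closed_midconvex_halfspace hdec).
pose clf (D : input R q m * R) := D.2 - ('D_(f S.1 + g S.1 *m D.1.1) (Vclf P xe) S.1 + c3 * Vclf P xe S.1).
pose lo k (D : input R q m * R) := D.1.1 k 0 - umin k 0.
pose up k (D : input R q m * R) := umax k 0 - D.1.1 k 0.
pose hocbf i (D : input R q m * R) := phiA_top f g A alA i S D.1 - eps.
pose avcbf (D : input R q m * R) := psi_top f g b A al S D.1.
(* One half-space per scalar constraint, given by its slack. *)
have -> : dec @^-1` [set D | qp_feasible f g b A al alA eps P xe c3 umin umax S D]
    = H clf `&` ((\bigcap_(k in setT) (H (lo k) `&` H (up k)))
      `&` ((\bigcap_(i in [set i | (1 <= i <= m)%N]) H (hocbf i)) `&` H avcbf)).
  apply/seteqP; split => v; rewrite /H /= /clf /lo /up /hocbf /=.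
    move=> [h1 [h2 [h3 h4]]]; split; first by rewrite subr_ge0.
    split; first by move=> k _; have /andP[? ?] := h2 k; split; rewrite /= subr_ge0.
    by split=> // i /h3; rewrite /= subr_ge0.
  move=> [h1 [h2 [h3 h4]]]; split; first by rewrite -subr_ge0.
  split; first by move=> k; have [] := h2 k I; rewrite /= !subr_ge0 => -> ->.
  by split=> // i /h3; rewrite /= subr_ge0.
apply: closed_midconvexI; first by apply/HP/clf_slack_affine/differentiable_Vclf.
apply: closed_midconvexI.
  apply: closed_midconvex_bigcap => k _.
  by apply: closed_midconvexI; apply: HP => a D D'; rewrite /lo /up /= !mxE; ring.
apply: closed_midconvexI; last by apply: HP; exact: Ld_input_affine.
apply: closed_midconvex_bigcap => i im; apply: HP.
rewrite /hocbf /phiA_top subSn; last by case/andP: im.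
(* Regrouped so that everything independent of the input, including [eps], forms the constant of
   [Ld_input_affine]. *)
rewrite /= (_ : (fun D => _) = fun D : input R q m * R =>
  Ld f g (phiA (q:=q) f g A alA i (m - i)) S D.1
  + (alA i (m - i).+1 (phiA (q:=q) f g A alA i (m - i) S) - eps)).
  by apply: Ld_input_affine; exact: dphi.
by apply/funext => D; rewrite addrA.
Qed.

Unset Implicit Arguments.

Theorem theorem3 (R : realType) (n q m : nat)
  (f : 'cV[R]_n -> 'cV[R]_n) (g : 'cV[R]_n -> 'M[R]_(n, q))
  (umin umax : 'cV[R]_q)
  (b : 'cV[R]_n -> R) (A : nat -> 'cV[R]_n -> R -> R)
  (al : nat -> R -> R) (alA : nat -> nat -> R -> R) (eps : R)
  (P : 'M[R]_n) (xe : 'cV[R]_n) (c3 Q : R) (Wt aw : nat -> R)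
  (Z0 : state R n m) :
  loc_lipschitz f -> loc_lipschitz g ->
  (forall k, umin k 0 <= umax k 0) ->
  0 < eps ->
  is_AVCBF (q:=q) (m:=m) f g b A al alA eps ->
  (* smoothness ("sufficiently differentiable") *)
  (* alpha_j is (m_a - j)-times differentiable, j < m_a *)
  (forall k, (1 <= k < m)%N -> ktimes_derivable (m - k) (al k)) ->
  (* alpha_{i,j} sufficiently differentiable: (m_a + 1 - i - j) times *)
  (forall i j, (1 <= i <= m)%N -> (1 <= j <= m - i)%N ->
     ktimes_derivable (m.+1 - i - j) (alA i j)) ->
  (* f, g, b, A_i sufficiently smooth: the functions that get differentiated
     along the dynamics are differentiable *)
  (forall i k (S : state R n m), (1 <= i <= m)%N -> (k <= m - i)%N ->
     differentiable (iterLF (q:=q) f g k (Alift (m:=m) A i)) S) ->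
  (forall i j (S : state R n m), (1 <= i <= m)%N -> (j <= m - i)%N ->
     differentiable (phiA (q:=q) f g A alA i j) S) ->
  (forall k (S : state R n m), (k < m)%N ->
     differentiable (iterLF (q:=q) f g k (blift (m:=m) b)) S) ->
  (forall k (S : state R n m), (k < m)%N ->
     differentiable (chi (q:=q) f g b A al k) S) ->
  (* CLF data and QP hyperparameters *)
  posdef P -> 0 < c3 -> 0 < Q -> (forall i, (1 <= i <= m)%N -> 0 < Wt i) ->
  (* Z(0) in C_0 /\ ... /\ C_{m_a - 1} *)
  (forall k, (k < m)%N -> 0 <= psi (q:=q) f g b A al k Z0) ->
  (* B_j^nu always positive *)
  (forall j (S : state R n m), (1 <= j <= m)%N -> 0 < Bnu (q:=q) f g A j S) ->
  forall S : state R n m, 0 < psi (q:=q) f g b A al m.-1 S ->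
    (exists D, qp_feasible (m:=m) f g b A al alA eps P xe c3 umin umax S D) /\
    (exists! D, qp_feasible (m:=m) f g b A al alA eps P xe c3 umin umax S D /\
       forall D', qp_feasible (m:=m) f g b A al alA eps P xe c3 umin umax S D' ->
         qp_cost (q:=q) (m:=m) Wt aw Q D <= qp_cost (q:=q) (m:=m) Wt aw Q D').
Proof.
move=> _ _ ubd _ [m0 [_ [hocbf [_ _]]]] _ _ dL dphi _ dchi _ _ Q0 Wt0 _ B0 S psi0.
have mm : (1 <= m <= m)%N by rewrite m0 leqnn.
have dchiS : differentiable (chi (q:=q) (m:=m) f g b A al m.-1) S.
  by apply: dchi; rewrite prednK.
have dA : differentiable (Alift (m:=m) A m) S by exact: (dL m 0%N).
have dpsi : differentiable (psi (q:=q) (m:=m) f g b A al m.-1) S.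
  rewrite (_ : psi _ _ _ _ _ _ = Alift A m * chi (q:=q) f g b A al m.-1).
    exact: differentiableM.
  by apply/funext => T; rewrite /psi prednK.
have chi0 : 0 < chi (q:=q) (m:=m) f g b A al m.-1 S.
  move: psi0; rewrite /psi prednK // pmulr_rgt0 //.
  by have [A0 _] := hocbf m mm; exact: A0.
have [nu [UVnu psinu]] := @exists_admissible_nu R n q m f g b A al alA eps S umin m0 dL dphi
  dchiS (fun j => B0 j S) chi0.
set F := qp_feasible f g b A al alA eps P xe c3 umin umax S.
have [D0 FD0] : exists D, F D.
  (* [umin] serves as the control, and [delta] equals the left side of the CLF constraint. *)
  exists ((umin, nu), 'D_(f S.1 + g S.1 *m umin) (Vclf P xe) S.1 + c3 * Vclf P xe S.1).
  by do ![split] => // k; rewrite lexx ubd.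
split; first by exists D0.
pose w k := enc (const_mx 1 : 'cV[R]_q, \col_(i < m) Wt i.+1, Q) 0 k.
pose c k := enc (0 : 'cV[R]_q, \col_(i < m) aw i.+1, 0) 0 k.
have w0 k : 0 < w k.
  rewrite /w /enc; case: (split_ordP k) => k' ->; first by rewrite row_mxEl !mxE ltr01.
  rewrite row_mxEr; case: (split_ordP k') => i ->; last by rewrite row_mxEr (ord1 i) mxE.
  by rewrite row_mxEl !mxE Wt0 //= ltn_ord.
have cF : closed_midconvex (dec @^-1` [set D | F D]).
  apply: qp_feasible_closed_midconvex => // i im; exact: dphi.
have F0 : dec @^-1` [set D | F D] !=set0 by exists (enc D0); rewrite -[D0]encK in FD0.
have [v [[Fv vmin] vuniq]] := wsq_unique_minimizer c w0 cF F0.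
exists (dec v); split=> [|D [FD Dmin]].
  split=> // D FD; have FeD : F (dec (enc D)) by rewrite encK.
  by rewrite -[D]encK !qp_cost_dec; exact: vmin.
have FeD : F (dec (enc D)) by rewrite encK.
(* A competing minimizer [D] is carried by [enc] to a minimizer of [wsq], hence to [v]. *)
rewrite -[RHS]encK; congr dec; apply: vuniq; split=> // y Fy.
by rewrite -!qp_cost_dec encK; exact: Dmin.
Qed.
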